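(* Let $\mathcal{M}=(M;\mu,\eta)$ be a monoid in $\mathbf{Rel}$ and let $N(\mathcal{M})$ be the corresponding simplicial set. Then: (i) $\mu$ has the cancellation property in the first coordinate if and only if $N(\mathcal{M})$ has the extension property with respect to $\Lambda^3_0\hookrightarrow\Delta^3$. (ii) $\mu$ has the cancellation property in the second coordinate if and only if $N(\mathcal{M})$ has the extension property with respect to $\Lambda^3_3\hookrightarrow\Delta^3$. (iii) $\mu$ is a partial operation if and only if $N(\mathcal{M})$ has the extension property with respect to $\Lambda^3_1\hookrightarrow\Delta^3$, or equivalently, if and only if $N(\mathcal{M})$ has the extension property with respect to $\Lambda^3_2\hookrightarrow\Delta^3$.
   Context: $\mathbf{Rel}$ is the category of sets and binary relations, monoidal under the cartesian product with unit a one-element set $\{\bullet\}$. $R\colon A\dashrightarrow B$ denotes a relation, and $R\colon a\dashrightarrow b$ means $a$ is $R$-related to $b$. A monoid in $\mathbf{Rel}$ is $(M;\mu,\eta)$ with relations $\mu\colon M\times M\dashrightarrow M$ and $\eta\colon\{\bullet\}\dashrightarrow M$ (identified with a subset $\eta\subseteq M$) such that $\mu\circ(\mu\times\mathrm{id})=\mu\circ(\mathrm{id}\times\mu)$ and $\mu\circ(\eta\times\mathrm{id})=\mathrm{id}=\mu\circ(\mathrm{id}\times\eta)$. A homomorphism $(M_1;\mu_1,\eta_1)\to(M_2;\mu_2,\eta_2)$ is a mapping $h\colon M_1\to M_2$ with $a\in\eta_1\Rightarrow h(a)\in\eta_2$ and $\mu_1\colon(a,b)\dashrightarrow c\Rightarrow\mu_2\colon(h(a),h(b))\dashrightarrow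 h(c)$. $\mu$ has the cancellation property in the first coordinate if $\mu\colon(a_1,b)\dashrightarrow c$ and $\mu\colon(a_2,b)\dashrightarrow c$ imply $a_1=a_2$; in the second coordinate if $\mu\colon(a,b_1)\dashrightarrow c$ and $\mu\colon(a,b_2)\dashrightarrow c$ imply $b_1=b_2$. $\mu$ is a partial operation if $\mu\colon(a,b)\dashrightarrow c_1$ and $\mu\colon(a,b)\dashrightarrow c_2$ imply $c_1=c_2$. The chain $[n]=\{0<\dots<n\}$ is viewed as a monoid in $\mathbf{Rel}$ (from the corresponding small category): elements are pairs $(i,j)$, $0\le i\le j\le n$; units are the pairs $(i,i)$; and $\mu\colon((j,k),(i,j))\dashrightarrow(i,k)$ are the only related elements. $N(\mathcal{M})$ is the simplicial set $[n]\mapsto\mathrm{Hom}([n],\mathcal{M})$ of monoid homomorphisms. Concretely $N(\mathcal{M})_0=\eta$, $N(\mathcal{M})_1=M$, and $N(\mathcal{M})_2$ is the set of triples $(a,b,c)$ with $\mu\colon(a,b)\dashrightarrow c$, where $a$ is the edge $12$, $b$ the edge $01$ and $c$ the edge $02$. $\Lambda^n_j=\bigcup_{i\ne j}\partial_i\Delta^n$ where $\partial_i\Delta^n$ is the face of the standard simplex $\Delta^n$ opposite the vertex $i$. For $m\colon A\to B$, a simplicial set $X$ has the extension property with respect to $m$ if every morphism $A\to X$ of simplicial sets factors through $m$. *)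

(* Defs.v *)
From mathcomp Require Import all_boot.
From mathcomp Require Import boolp.

Set Implicit Arguments.
Unset Strict Implicit.
Unset Printing Implicit Defensive.

#[local] Obligation Tactic := idtac.

(* Relations are Prop-valued and equality of relations is extensional.  The
   coherence isomorphisms of (Rel, *, unit), left implicit on paper, appear as
   graphs of functions. *)

Definition brel (A B : Type) := A -> B -> Prop.

Definition brel_eq A B (r s : brel A B) := forall a b, r a b <-> s a b.

Definition graph A B (f : A -> B) : brel A B := fun a b => f a = b.

Definition brel_id A : brel A A := graph id.

Definition brel_comp A B C (s : brel B C) (r : brel A B) : brel A C :=
  fun a c => exists2 b, r a b & s b c.

Definition brel_prod A B C D (r : brel A B) (s : brel C D) :
    brel (A * C) (B * D) :=
  fun x y => r x.1 y.1 /\ s x.2 y.2.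

Definition prod_assoc A B C (x : (A * B) * C) : A * (B * C) :=
  (x.1.1, (x.1.2, x.2)).

Record relMonoid := RelMonoid {
  carrier :> Type;
  mu : brel (carrier * carrier) carrier;
  eta : brel unit carrier;
  mu_assoc :
    brel_eq (brel_comp mu (brel_prod mu (@brel_id carrier)))
            (brel_comp (brel_comp mu (brel_prod (@brel_id carrier) mu))
                       (graph (@prod_assoc carrier carrier carrier)));
  mu_unitl :
    brel_eq (brel_comp mu (brel_prod eta (@brel_id carrier))) (graph snd);
  mu_unitr :
    brel_eq (brel_comp mu (brel_prod (@brel_id carrier) eta)) (graph fst)
}.

Arguments mu {r}.
Arguments eta {r}.

Record relMonoid_hom (M1 M2 : relMonoid) := RelMonoidHom {
  rhom_fun :> M1 -> M2;
  rhom_eta : forall a : M1, eta tt a -> eta tt (rhom_fun a);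
  rhom_mu : forall a b c : M1,
    mu (a, b) c -> mu (rhom_fun a, rhom_fun b) (rhom_fun c)
}.

Lemma relMonoid_hom_ext (M1 M2 : relMonoid) (g h : relMonoid_hom M1 M2) :
  g =1 h -> g = h.
Proof.
case: g => g g1 g2; case: h => h h1 h2 /= /funext gh.
by case: _ / gh in h1 h2 *; congr RelMonoidHom; apply: Prop_irrelevance.
Qed.

Program Definition relMonoid_hom_comp (M1 M2 M3 : relMonoid)
    (h : relMonoid_hom M2 M3) (g : relMonoid_hom M1 M2) :
    relMonoid_hom M1 M3 :=
  @RelMonoidHom M1 M3 (h \o g) _ _.
Next Obligation. by move=> M1 M2 M3 h g a ea; do 2 apply: rhom_eta. Qed.
Next Obligation. by move=> M1 M2 M3 h g a b c m; do 2 apply: rhom_mu. Qed.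

Definition cancellative_fst A B C (m : brel (A * B) C) :=
  forall a1 a2 b c, m (a1, b) c -> m (a2, b) c -> a1 = a2.

Definition cancellative_snd A B C (m : brel (A * B) C) :=
  forall a b1 b2 c, m (a, b1) c -> m (a, b2) c -> b1 = b2.

Definition partial_operation A B C (m : brel (A * B) C) :=
  forall a b c1 c2, m (a, b) c1 -> m (a, b) c2 -> c1 = c2.

(* The simplex category: [n] is 'I_n.+1. *)

Record mono (m n : nat) := Mono {
  mono_fun :> 'I_m.+1 -> 'I_n.+1;
  monoP : {homo mono_fun : i j / i <= j}
}.

Lemma mono_ext m n (f g : mono m n) : f =1 g -> f = g.
Proof.
case: f => f f1; case: g => g g1 /= /funext fg.
by case: _ / fg in g1 *; congr Mono; apply: Prop_irrelevance.
Qed.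

Definition mono_id n : mono n n := @Mono n n id (fun _ _ ij => ij).

Definition mono_comp m n p (g : mono n p) (f : mono m n) : mono m p :=
  @Mono m p (g \o f) (fun _ _ ij => monoP g (monoP f ij)).

Record sset := SSet {
  simplex :> nat -> Type;
  sact : forall m n, mono m n -> simplex n -> simplex m;
  sact_id : forall n (x : simplex n), sact (mono_id n) x = x;
  sact_comp : forall m n p (g : mono n p) (f : mono m n) (x : simplex p),
    sact (mono_comp g f) x = sact f (sact g x)
}.

Arguments sact {s m n}.

Record sset_hom (X Y : sset) := SSetHom {
  shom_fun :> forall n, X n -> Y n;
  shom_nat : forall m n (f : mono m n) (x : X n),
    shom_fun (sact f x) = sact f (shom_fun x)
}.

Lemma sset_hom_ext (X Y : sset) (u v : sset_hom X Y) :
  (forall n (x : X n), u n x = v n x) -> u = v.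
Proof.
case: u => u u1; case: v => v v1 /= uv.
have {}uv : u = v by apply: functional_extensionality_dep => n; apply/funext/uv.
by case: _ / uv in v1 *; congr SSetHom; apply: Prop_irrelevance.
Qed.

Program Definition sset_hom_comp (X Y Z : sset) (v : sset_hom Y Z)
    (u : sset_hom X Y) : sset_hom X Z :=
  @SSetHom X Z (fun n x => v n (u n x)) _.
Next Obligation. by move=> X Y Z v u m n f x /=; rewrite !shom_nat. Qed.

Definition extension_property (X A B : sset) (m : sset_hom A B) :=
  forall u : sset_hom A X, exists v : sset_hom B X, u = sset_hom_comp v m.

Record subsset (X : sset) := SubSSet {
  in_subsset :> forall n, X n -> Prop;
  subsset_act : forall m n (f : mono m n) (x : X n),
    in_subsset x -> in_subsset (sact f x)
}.

Program Definition sset_of (X : sset) (A : subsset X) : sset :=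
  @SSet (fun n => {x : X n | A n x})
        (fun m n f x => exist _ (sact f (sval x)) (subsset_act f (svalP x))) _ _.
Next Obligation. by move=> X A n [x Ax]; apply/eq_exist; apply: sact_id. Qed.
Next Obligation.
by move=> X A m n p g f [x Ax]; apply/eq_exist; apply: sact_comp.
Qed.

Definition subsset_incl (X : sset) (A : subsset X) : sset_hom (sset_of A) X :=
  @SSetHom (sset_of A) X (fun n x => sval x) (fun _ _ _ _ => erefl).

Program Definition subsset_bigcup (X : sset) (I : Type) (P : I -> Prop)
    (A : I -> subsset X) : subsset X :=
  @SubSSet X (fun n x => exists2 i, P i & A i n x) _.
Next Obligation.
by move=> X I P A m n f x [i Pi Ax]; exists i => //; apply: subsset_act.
Qed.

Program Definition std_simplex (n : nat) : sset :=
  @SSet (fun m => mono m n) (fun m p f x => mono_comp x f) _ _.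
Next Obligation. by move=> n m x; apply: mono_ext. Qed.
Next Obligation. by move=> n m p q g f x; apply: mono_ext. Qed.

(* The face opposite the vertex i: the simplices that avoid i. *)
Program Definition face (n : nat) (i : 'I_n.+1) : subsset (std_simplex n) :=
  @SubSSet (std_simplex n) (fun m (x : mono m n) => forall k, x k <> i) _.
Next Obligation. by move=> n i m p f x xi k; apply: xi. Qed.

Definition horn (n : nat) (j : 'I_n.+1) : subsset (std_simplex n) :=
  subsset_bigcup (fun i => i <> j) (@face n).

Definition horn_incl (n : nat) (j : 'I_n.+1) :
    sset_hom (sset_of (horn j)) (std_simplex n) :=
  subsset_incl (horn j).

(* The pair (i, j) stands for the unique arrow i -> j of the category [n], and
   mu is composition of arrows, with the arrow applied last written first. *)

Definition chain_elt (n : nat) :=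
  {p : 'I_n.+1 * 'I_n.+1 | p.1 <= p.2}.

Definition chain_mu n : brel (chain_elt n * chain_elt n) (chain_elt n) :=
  fun x c => exists i j k : 'I_n.+1,
    [/\ val x.1 = (j, k), val x.2 = (i, j) & val c = (i, k)].

Definition chain_eta n : brel unit (chain_elt n) :=
  fun _ c => exists i : 'I_n.+1, val c = (i, i).

Lemma chain_muE n (a b c : chain_elt n) :
  chain_mu (a, b) c <->
  [/\ (val a).1 = (val b).2, (val c).1 = (val b).1 & (val c).2 = (val a).2].
Proof.
split=> [[i [j [k [/= -> -> ->]]]]//|[h1 h2 h3]].
exists (val b).1, (val b).2, (val a).2; split=> /=.
- by rewrite -h1 -surjective_pairing.
- by rewrite -surjective_pairing.
- by rewrite -h2 -h3 -surjective_pairing.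
Qed.

Lemma chain_etaE n (c : chain_elt n) : chain_eta tt c <-> (val c).1 = (val c).2.
Proof.
split=> [[i ->]//|h]; exists (val c).1.
by rewrite {2}h -surjective_pairing.
Qed.

Lemma chain_ext n (a b : chain_elt n) :
  (val a).1 = (val b).1 -> (val a).2 = (val b).2 -> a = b.
Proof.
by case: a b => [[a1 a2] ha] [[b1 b2] hb] /= e1 e2; apply: val_inj; rewrite /= e1 e2.
Qed.

Program Definition chain (n : nat) : relMonoid :=
  @RelMonoid (chain_elt n) (@chain_mu n) (@chain_eta n) _ _ _.
Next Obligation.
move=> n [[a b] c] d; split.
- case=> [[e c'] [/= /chain_muE [h1 h2 h3] <-] /chain_muE [h4 h5 h6]].
  have lt : (val c).1 <= (val b).2.
    apply: leq_trans (valP c) _; rewrite -h4 h2; exact: valP b.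
  exists (a, (b, c)); first by [].
  exists (a, exist _ ((val c).1, (val b).2) lt).
    by split=> //=; apply/chain_muE; split=> //; rewrite -h4 h2.
  by apply/chain_muE; split=> //=; rewrite ?h6 ?h3.
- case=> x <- [[a' e] [/= <- /chain_muE [h1 h2 h3]] /chain_muE [h4 h5 h6]].
  have lt : (val b).1 <= (val a).2.
    by apply: leq_trans (valP b) _; rewrite -h3 -h4; exact: valP a.
  exists (exist _ ((val b).1, (val a).2) lt, c).
    by split=> //=; apply/chain_muE; split=> //=; rewrite h4 h3.
  by apply/chain_muE; split=> //=; rewrite ?h5 ?h2.
Qed.
Next Obligation.
move=> n [[] a] b; split.
- case=> [[e a'] [/= /chain_etaE h <-] /chain_muE [h1 h2 h3]].
  by apply: chain_ext => //=; rewrite h3 -h h1.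
- move=> /= <-; exists (exist _ ((val a).2, (val a).2) (leqnn _), a).
    by split=> //=; apply/chain_etaE.
  by apply/chain_muE.
Qed.
Next Obligation.
move=> n [a []] b; split.
- case=> [[a' e] [/= <- /chain_etaE h] /chain_muE [h1 h2 h3]].
  by apply: chain_ext => //=; rewrite h2 h -h1.
- move=> /= <-; exists (a, exist _ ((val a).1, (val a).1) (leqnn _)).
    by split=> //=; apply/chain_etaE.
  by apply/chain_muE.
Qed.

Definition chain_map_fun m n (f : mono m n) (a : chain_elt m) : chain_elt n :=
  exist _ (f (val a).1, f (val a).2) (monoP f (valP a)).

Program Definition chain_map m n (f : mono m n) :
    relMonoid_hom (chain m) (chain n) :=
  @RelMonoidHom (chain m) (chain n) (chain_map_fun f) _ _.
Next Obligation.
by move=> m n f a /chain_etaE h; apply/chain_etaE => /=; rewrite h.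
Qed.
Next Obligation.
move=> m n f a b c /chain_muE [h1 h2 h3].
by apply/chain_muE; rewrite /= h1 h2 h3.
Qed.

Program Definition nerve (M : relMonoid) : sset :=
  @SSet (fun n => relMonoid_hom (chain n) M)
        (fun m n f h => relMonoid_hom_comp h (chain_map f)) _ _.
Next Obligation.
move=> M n h; apply: relMonoid_hom_ext => a /=; congr (h _).
exact: chain_ext.
Qed.
Next Obligation.
move=> M m n p g f h; apply: relMonoid_hom_ext => a /=; congr (h _).
exact: chain_ext.
Qed.

(* Main.v *)
(** A map from a 3-dimensional horn into [nerve M] is a labelling of the six
    edges of the simplex that satisfies the multiplication condition on the
    three given faces (the vertices are then the units determined by the
    edges), and it extends iff the condition also holds on the missing face.
    The given faces put [a03] in a triple product [a23 a12 a01]; rebracketing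
    factors it through some [x], and cancellation (or single-valuedness)
    identifies [x] with the remaining edge, which is the missing condition.
    Conversely, making one edge of the missing face a unit turns its condition
    into an equality. *)

Require Import Defs.
From mathcomp Require Import all_boot.
From mathcomp Require Import boolp.

Set Implicit Arguments.
Unset Strict Implicit.
Unset Printing Implicit Defensive.

(** * Rebracketing and units in a monoid in Rel *)

Section Units.
Variable M : relMonoid.
Implicit Types a b c d e x : M.

Lemma mu_assocr a b c d x :
  mu (a, b) x -> mu (x, c) d -> exists2 y, mu (b, c) y & mu (a, y) d.
Proof.
move=> abx xcd; have [/(_ _)] := @mu_assoc M ((a, b), c) d.
case; first by exists (x, c).
move=> _ <- [[a' y] [/= <- bcy] ayd] _.
by exists y.
Qed.

Lemma mu_assocl a b c d y :
  mu (b, c) y -> mu (a, y) d -> exists2 x, mu (a, b) x & mu (x, c) d.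
Proof.
move=> bcy ayd; have [_ /(_ _)] := @mu_assoc M ((a, b), c) d.
case; first by exists (a, (b, c)) => //; exists (a, y).
by move=> [x c'] [/= abx <-] xcd; exists x.
Qed.

Lemma mu_eta_l e a b : eta tt e -> mu (e, a) b -> a = b.
Proof.
by move=> ee eab; apply: (proj1 (@mu_unitl M (tt, a) b)); exists (e, a).
Qed.

Lemma mu_eta_r e a b : eta tt e -> mu (a, e) b -> a = b.
Proof.
by move=> ee aeb; apply: (proj1 (@mu_unitr M (a, tt) b)); exists (a, e).
Qed.

Lemma target_ex a : exists e, eta tt e /\ mu (e, a) a.
Proof.
have [_ /(_ erefl) [[e a'] [/= ee <-] eaa]] := @mu_unitl M (tt, a) a.
by exists e.
Qed.

Lemma source_ex a : exists e, eta tt e /\ mu (a, e) a.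
Proof.
have [_ /(_ erefl) [[a' e] [/= <- ee] aea]] := @mu_unitr M (a, tt) a.
by exists e.
Qed.

(** The first argument of [mu] is the arrow applied last, so the unit acting from the left sits at
    the target of [a]. *)
Definition target a := sval (cid (target_ex a)).
Definition source a := sval (cid (source_ex a)).

Lemma targetP a : eta tt (target a) /\ mu (target a, a) a.
Proof. exact: svalP (cid (target_ex a)). Qed.

Lemma sourceP a : eta tt (source a) /\ mu (a, source a) a.
Proof. exact: svalP (cid (source_ex a)). Qed.

Lemma mu_eta_eq e e' x : eta tt e -> eta tt e' -> mu (e, e') x -> e = e'.
Proof.
by move=> ee ee' m; rewrite (mu_eta_r ee' m) (mu_eta_l ee m).
Qed.

Lemma mu_eta_id e : eta tt e -> mu (e, e) e.
Proof.
move=> ee; have [ee' m] := sourceP e.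
by move: (m); rewrite -(mu_eta_eq ee ee' m).
Qed.

(** Rebracketing shows that [target a] also acts on [c]; rebracketing again composes it with
    [target c], and composable units coincide. The next two lemmas follow the same pattern. *)
Lemma mu_target a b c : mu (a, b) c -> target a = target c.
Proof.
move=> abc; have [e1 m1] := targetP a; have [e2 m2] := targetP c.
have [y _ /[dup] /(mu_eta_l e1) -> m3] := mu_assocr m1 abc.
by have [x m _] := mu_assocl m3 m2; rewrite (mu_eta_eq e2 e1 m).
Qed.

Lemma mu_source a b c : mu (a, b) c -> source b = source c.
Proof.
move=> abc; have [e1 m1] := sourceP b; have [e2 m2] := sourceP c.
have [y _ /[dup] /(mu_eta_r e1) -> m3] := mu_assocl m1 abc.
by have [x m _] := mu_assocr m3 m2; rewrite (mu_eta_eq e1 e2 m).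
Qed.

Lemma mu_middle a b c : mu (a, b) c -> source a = target b.
Proof.
move=> abc; have [e1 m1] := sourceP a; have [e2 m2] := targetP b.
have [y /[dup] /(mu_eta_l e1) <- eby _] := mu_assocr m1 abc.
by have [x m _] := mu_assocl m2 eby; apply: mu_eta_eq m.
Qed.

End Units.

(** * Edges as 1-simplices of the standard simplex *)

Definition seq_mono n (i : 'I_n.+1) (s : seq 'I_n.+1)
    (si : sorted (relpre val leq) (i :: s)) : mono (size s) n.
Proof.
exists (fun p => nth i (i :: s) p) => p q pq.
apply: (sorted_leq_nth _ _ _ si) => //; rewrite ?inE ?ltn_ord //.
- by move=> x y z; apply: leq_trans.
- by move=> x; apply: leqnn.
(* Transparent, so that values at concrete positions compute. *)
Defined.

Definition edge n (a : chain_elt n) : mono 1 n :=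
  @seq_mono n (val a).1 [:: (val a).2] (introT andP (conj (valP a) isT)).

(** The universal arrow: every chain element is its image under the corresponding edge. *)
Definition chain01 : chain_elt 1 := exist _ (ord0, ord_max) isT.

Lemma edge_chain01 n (a : chain_elt n) : chain_map_fun (edge a) chain01 = a.
Proof. exact: chain_ext. Qed.

Lemma edge_comp m n (x : mono m n) (a : chain_elt m) :
  mono_comp x (edge a) = edge (chain_map_fun x a).
Proof. by apply: mono_ext => -[[|[|//]] ?]. Qed.

(** Pigeonhole: three values cannot exhaust [n.+1 > 3] vertices. *)
Lemma ord_avoid3 n (i j k : 'I_n.+1) :
  2 < n -> exists2 l, l <> i & l \notin [:: j; k].
Proof.
move=> n2; have [|s] := boolP (all (mem [:: i; j; k]) (enum 'I_n.+1)).
  move/allP/(uniq_leq_size (enum_uniq _)); rewrite size_enum_ord /=.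
  by rewrite ltnNge n2.
have /allPn[l _] := s; rewrite !inE negb_or => /andP[/eqP li lj].
by exists l => //; rewrite !inE.
Qed.

(** * Maps out of a horn as edge labellings *)

Section HornData.
Variables (M : relMonoid) (n : nat) (v : 'I_n.+1).
Hypothesis n2 : 2 < n.

Lemma edge_in_horn (a : chain_elt n) : horn v 1 (edge a).
Proof.
have [l lv la] := ord_avoid3 v (val a).1 (val a).2 n2.
exists l => // k kl; move: la; rewrite -kl.
by case: k {kl} => [[|[|//]] ?]; rewrite !inE eqxx ?orbT.
Qed.

(** Naturality along [edge a]; hence a map out of the horn is determined by its values on edges. *)
Lemma horn_map_edge (u : sset_hom (sset_of (horn v)) (nerve M)) m
    (x : mono m n) (hx : horn v m x) (a : chain_elt m) :
  u m (exist _ x hx) a =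
  u 1 (exist _ _ (edge_in_horn (chain_map_fun x a))) chain01.
Proof.
have -> : exist _ _ (edge_in_horn (chain_map_fun x a)) =
          sact (edge a) (exist _ x hx : sset_of (horn v) m).
  by apply/eq_exist; rewrite /= edge_comp.
by rewrite shom_nat /= edge_chain01.
Qed.

(** The vertex [l] witnesses that the triangle, possibly degenerate, lies in the horn. *)
Definition horn_edge_labelling (h : chain_elt n -> M) :=
  (forall a, chain_eta tt a -> eta tt (h a)) /\
  forall a b c, chain_mu (a, b) c ->
    (exists2 l, l <> v & l \notin [:: (val b).1; (val b).2; (val a).2]) ->
    mu (h a, h b) (h c).

(** All edges lie in the horn, so a horn map labels the whole chain; by Yoneda, it extends exactly
    when this labelling is a homomorphism. *)
Lemma horn_extensionP :
  extension_property (nerve M) (horn_incl v) <->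
  forall h, horn_edge_labelling h ->
    forall a b c, chain_mu (a, b) c -> mu (h a, h b) (h c).
Proof.
split=> [ext h [h1 h2] | fill u].
- have hom_eta m (x : mono m n) (a : chain m) :
    eta tt a -> eta tt (h (chain_map_fun x a)).
    by move=> ea; apply: h1; apply: (rhom_eta (chain_map x)).
  have hom_mu m (x : mono m n) (hx : horn v m x) (a b c : chain m) :
    mu (a, b) c -> mu (h (chain_map_fun x a), h (chain_map_fun x b))
                      (h (chain_map_fun x c)).
    move=> abc; apply: h2; first exact: (rhom_mu (chain_map x) abc).
    have [l lv xl] := hx; exists l => //.
    by rewrite !inE !negb_or !(eq_sym l) !(introF eqP (xl _)).
  pose uf m (x : sset_of (horn v) m) : nerve M m :=
    @RelMonoidHom (chain m) M _ (hom_eta m (sval x)) (hom_mu m _ (svalP x)).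
  have unat m p (f : mono m p) (x : sset_of (horn v) p) :
    uf m (sact f x) = sact f (uf p x).
    by apply: relMonoid_hom_ext => a /=; congr h; apply: chain_ext.
  have [w uw] := ext (SSetHom unat).
  (* The value of the extension at the identity simplex is the homomorphism sought; it agrees with
     [h] on each edge. *)
  have wh a : w n (mono_id n) a = h a.
    rewrite -[a in LHS]edge_chain01.
    have -> : w n (mono_id n) (chain_map_fun (edge a) chain01) =
              sact (edge a) (w n (mono_id n)) chain01 by [].
    rewrite -shom_nat.
    have -> : sact (edge a) (mono_id n : std_simplex n n) = edge a.
      exact: mono_ext.
    have := congr1 (fun z : sset_hom (sset_of (horn v)) (nerve M) =>
       z 1 (exist _ _ (edge_in_horn a)) chain01) uw.
    by rewrite /= => <-; rewrite edge_chain01.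
  move=> a b c abc; rewrite -!wh; exact: (rhom_mu (w n (mono_id n)) abc).
- pose h a := u 1 (exist _ _ (edge_in_horn a)) chain01.
  have hl : horn_edge_labelling h.
    split=> [a /chain_etaE aa | a b c /chain_muE [ab cb ca] [l lv lab]].
      rewrite /h; have -> : a = chain_map_fun (edge a)
          (exist _ (ord0, ord0) isT : chain_elt 1) by apply: chain_ext.
      rewrite -(horn_map_edge u (edge_in_horn a)).
      by apply: rhom_eta; apply/chain_etaE.
    (* The product condition is read off the 2-simplex on these three vertices, which misses [l] and
       so lies in the horn. *)
    have s : sorted (relpre val leq) [:: (val b).1; (val b).2; (val a).2].
      by rewrite /= (valP b) -ab (valP a).
    have hx : horn v 2 (seq_mono s).
      exists l => // k kl; move/negP: lab; apply; rewrite -kl.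
      by case: k {kl} => [[|[|[|//]]] ?]; rewrite !inE eqxx ?orbT.
    have o1 : 1 < 3 by [].
    pose c12 : chain_elt 2 := exist _ (Ordinal o1, ord_max) isT.
    pose c01 : chain_elt 2 := exist _ (ord0, Ordinal o1) isT.
    pose c02 : chain_elt 2 := exist _ (ord0, ord_max) isT.
    have hE p q : chain_map_fun (seq_mono s) p = q ->
        h q = u 2 (exist _ _ hx) p by move=> <-; rewrite horn_map_edge.
    rewrite (hE c12 a) ?(hE c01 b) ?(hE c02 c); try exact: chain_ext.
    by apply: rhom_mu; apply/chain_muE.
  pose g : relMonoid_hom (chain n) M :=
    @RelMonoidHom (chain n) M h hl.1 (fill h hl).
  pose w m (x : std_simplex n m) : nerve M m :=
    relMonoid_hom_comp g (chain_map x).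
  have wnat m p (f : mono m p) (x : std_simplex n p) :
    w m (sact f x) = sact f (w p x).
    by apply: relMonoid_hom_ext => a /=; congr h; apply: chain_ext.
  exists (SSetHom wnat); apply: sset_hom_ext => m [x hx].
  by apply: relMonoid_hom_ext => a; rewrite horn_map_edge.
Qed.

End HornData.

(** * Horns in the tetrahedron, described by six edges *)

Definition edge01 : chain_elt 3 :=
  exist _ (@Ordinal 4 0 isT, @Ordinal 4 1 isT) isT.
Definition edge02 : chain_elt 3 :=
  exist _ (@Ordinal 4 0 isT, @Ordinal 4 2 isT) isT.
Definition edge03 : chain_elt 3 :=
  exist _ (@Ordinal 4 0 isT, @Ordinal 4 3 isT) isT.
Definition edge12 : chain_elt 3 :=
  exist _ (@Ordinal 4 1 isT, @Ordinal 4 2 isT) isT.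
Definition edge13 : chain_elt 3 :=
  exist _ (@Ordinal 4 1 isT, @Ordinal 4 3 isT) isT.
Definition edge23 : chain_elt 3 :=
  exist _ (@Ordinal 4 2 isT, @Ordinal 4 3 isT) isT.

Section Horn3.
Variables (M : relMonoid) (v : 'I_4).

(** Any three triangles already force edges meeting at a vertex to share their unit there, so the
    vertices can be labelled consistently. *)
Lemma horn3_vertices (a01 a02 a03 a12 a13 a23 : M) :
  (v <> 3 :> nat -> mu (a12, a01) a02) ->
  (v <> 2 :> nat -> mu (a13, a01) a03) ->
  (v <> 1 :> nat -> mu (a23, a02) a03) ->
  (v <> 0 :> nat -> mu (a23, a12) a13) ->
  [/\ [/\ source a02 = source a01 & source a03 = source a01],
      [/\ source a12 = target a01 & source a13 = target a01],
      [/\ target a12 = target a02 & source a23 = target a02] &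
      [/\ target a13 = target a03 & target a23 = target a03]].
Proof.
move=> m012 m013 m023 m123; case: (posnP v) => [v0|v_gt0].
  have m1 := m012 ltac:(by rewrite v0); have m2 := m013 ltac:(by rewrite v0).
  have m3 := m023 ltac:(by rewrite v0).
  move: (mu_source m1) (mu_source m2) (mu_source m3) (mu_target m1)
    (mu_target m2) (mu_target m3) (mu_middle m1) (mu_middle m2) (mu_middle m3).
  by do !split; congruence.
have m4 := m123 ltac:(by move=> v0; rewrite v0 in v_gt0).
move: (mu_source m4) (mu_target m4) (mu_middle m4).
have [v1|/eqP v1] := eqVneq (val v) 1.
  have m1 := m012 ltac:(by rewrite v1); have m2 := m013 ltac:(by rewrite v1).
  move: (mu_source m1) (mu_source m2) (mu_target m1)
    (mu_target m2) (mu_middle m1) (mu_middle m2).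
  by do !split; congruence.
have m3 := m023 v1.
move: (mu_source m3) (mu_target m3) (mu_middle m3).
have [v2|/eqP v2] := eqVneq (val v) 2.
  have m1 := m012 ltac:(by rewrite v2).
  move: (mu_source m1) (mu_target m1) (mu_middle m1).
  by do !split; congruence.
have m2 := m013 v2; move: (mu_source m2) (mu_target m2) (mu_middle m2).
by do !split; congruence.
Qed.

(** Each guard says that the face opposite the given vertex belongs to the horn. Degenerate
    triangles impose nothing further on the six edges. *)
Lemma horn3_extensionP :
  extension_property (nerve M) (horn_incl v) <->
  forall a01 a02 a03 a12 a13 a23 : M,
    (v <> 3 :> nat -> mu (a12, a01) a02) ->
    (v <> 2 :> nat -> mu (a13, a01) a03) ->
    (v <> 1 :> nat -> mu (a23, a02) a03) ->
    (v <> 0 :> nat -> mu (a23, a12) a13) ->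
    [/\ mu (a12, a01) a02, mu (a13, a01) a03,
        mu (a23, a02) a03 & mu (a23, a12) a13].
Proof.
rewrite horn_extensionP //; split=> [ext | fill h [h1 h2]].
- move=> a01 a02 a03 a12 a13 a23 m012 m013 m023 m123.
  have [[s02 s03] [s12 s13] [t12 s23] [t13 t23]] :=
    horn3_vertices m012 m013 m023 m123.
  (* The last clause is the edge 23; pairs (i, j) with i > j do not occur. *)
  pose h (a : chain_elt 3) : M := match val (val a).1, val (val a).2 with
    | 0, 0 => source a01 | 1, 1 => target a01
    | 2, 2 => target a02 | 3, 3 => target a03
    | 0, 1 => a01 | 0, 2 => a02 | 0, 3 => a03
    | 1, 2 => a12 | 1, 3 => a13 | _, _ => a23 end.
  have hl : horn_edge_labelling v h.
    split=> [[[i j] ij] /chain_etaE /= e|].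
      subst j; case: i ij => [[|[|[|[|//]]]] ?] ?; rewrite /h /=;
        solve [exact: (sourceP _).1 | exact: (targetP _).1].
    move=> [[j' k] jk] [[i j] ij] [[i' k'] ik] /chain_muE /= [].
    move=> ? ? ?; subst j' i' k' => -[l lv].
    have avoids l' (x y z : 'I_4) : l' \notin [:: x; y; z] ->
        [/\ l' <> x :> nat, l' <> y :> nat & l' <> z :> nat].
      by rewrite !inE !negb_or => /and3P[/eqP lx /eqP ly /eqP lz]; split;
        move/val_inj.
    move=> /avoids /=; clear avoids.
    have sid a : mu (source a, source a) (source a).
      by apply/mu_eta_id/(sourceP a).1.
    have tid a : mu (target a, target a) (target a).
      by apply/mu_eta_id/(targetP a).1.
    have sm a e : source a = e -> mu (a, e) a by move=> <-; case: (sourceP a).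
    have tm a e : target a = e -> mu (e, a) a by move=> <-; case: (targetP a).
    (* Triangles with a repeated vertex hold by the unit laws; the four goals left are the proper
       faces. *)
    case: i ij ik => [[|[|[|[|//]]]] ?] ij ik;
    case: j jk ij => [[|[|[|[|//]]]] ?] jk ij //;
    case: k jk ik => [[|[|[|[|//]]]] ?] jk ik //;
    case: l lv => [[|[|[|[|//]]]] ?] lv [] //= ? ? ?; rewrite /h /=;
    try solve [exact: sid | exact: tid | exact: sm | exact: tm].
    + by apply: m012 => e; apply: lv; apply: val_inj.
    + by apply: m013 => e; apply: lv; apply: val_inj.
    + by apply: m023 => e; apply: lv; apply: val_inj.
    + by apply: m123 => e; apply: lv; apply: val_inj.
  split.
  + by apply: (ext h hl edge12 edge01 edge02); apply/chain_muE.
  + by apply: (ext h hl edge13 edge01 edge03); apply/chain_muE.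
  + by apply: (ext h hl edge23 edge02 edge03); apply/chain_muE.
  + by apply: (ext h hl edge23 edge12 edge13); apply/chain_muE.
- have tri a b c l : chain_mu (a, b) c -> (v <> l :> nat) ->
      l \notin [:: val (val b).1; val (val b).2; val (val a).2] -> l < 4 ->
      mu (h a, h b) (h c).
    move=> abc vl; rewrite !inE => lab l4; apply: h2 => //.
    by exists (Ordinal l4); [move=> e; apply: vl; rewrite -e | rewrite !inE].
  have [| | | |m012 m013 m023 m123] := fill (h edge01) (h edge02) (h edge03)
    (h edge12) (h edge13) (h edge23).
  + by move=> vl; apply: (tri _ _ _ 3) => //; apply/chain_muE.
  + by move=> vl; apply: (tri _ _ _ 2) => //; apply/chain_muE.
  + by move=> vl; apply: (tri _ _ _ 1) => //; apply/chain_muE.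
  + by move=> vl; apply: (tri _ _ _ 0) => //; apply/chain_muE.
  move=> a b c /[dup] abc /chain_muE [ab cb ca].
  (* A degenerate triangle has at most two distinct vertices, so it avoids some vertex other than
     [v] and lies in the horn. *)
  have [bd|bnd] := eqVneq (val b).1 (val b).2.
    have [l lv lab] := ord_avoid3 v (val b).2 (val a).2 isT.
    by apply: h2 => //; exists l => //; rewrite bd inE negb_or lab; move: lab;
      rewrite !inE negb_or andbT => /andP[].
  have [ad|andd] := eqVneq (val a).1 (val a).2.
    have [l lv lab] := ord_avoid3 v (val b).1 (val a).2 isT.
    by apply: h2 => //; exists l => //; rewrite -ab ad; move: lab;
      rewrite !inE !negb_or => /andP[-> ->].
  have hE x y : val (val x).1 = val (val y).1 ->
      val (val x).2 = val (val y).2 -> h x = h y.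
    by move=> /val_inj e1 /val_inj e2; rewrite (chain_ext e1 e2).
  have blt : val (val b).1 < val (val b).2 by rewrite ltn_neqAle bnd (valP b).
  have alt : val (val b).2 < val (val a).2
    by rewrite -ab ltn_neqAle andd (valP a).
  have a4 : val (val a).2 < 4 := ltn_ord _.
  have : [\/ [/\ val (val b).1 = 0, val (val b).2 = 1 & val (val a).2 = 2],
             [/\ val (val b).1 = 0, val (val b).2 = 1 & val (val a).2 = 3],
             [/\ val (val b).1 = 0, val (val b).2 = 2 & val (val a).2 = 3] |
             [/\ val (val b).1 = 1, val (val b).2 = 2 & val (val a).2 = 3]].
    move: a4 alt blt; case: (val (val a).2) => [|[|[|[|//]]]] //= _;
    case: (val (val b).2) => [|[|[|//]]] //= _;
    case: (val (val b).1) => [|[|//]] //= _;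
    solve [exact: Or41 | exact: Or42 | exact: Or43 | exact: Or44].
  have hE3 x y z : mu (h x, h y) (h z) ->
      val (val b).1 = val (val y).1 -> val (val b).2 = val (val y).2 ->
      val (val a).2 = val (val x).2 -> (val x).1 = (val y).2 ->
      (val z).1 = (val y).1 -> (val z).2 = (val x).2 -> mu (h a, h b) (h c).
    move=> m b1 b2 a2 xy zy zx.
    have -> : h a = h x by apply: (hE _ _ _ a2); rewrite ab xy; exact: b2.
    have -> : h b = h y by exact: hE b1 b2.
    have -> // : h c = h z by apply: hE; rewrite ?cb ?ca ?zy ?zx; assumption.
  by case=> -[b1 b2 a2]; [apply: (hE3 edge12 edge01 edge02)
    | apply: (hE3 edge13 edge01 edge03) | apply: (hE3 edge23 edge02 edge03)
    | apply: (hE3 edge23 edge12 edge13)].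
Qed.

End Horn3.

Theorem theorem4p2 (M : relMonoid) :
  [/\ cancellative_fst (@mu M) <->
        extension_property (nerve M) (horn_incl (ord0 : 'I_4)),
      cancellative_snd (@mu M) <->
        extension_property (nerve M) (horn_incl (ord_max : 'I_4)),
      partial_operation (@mu M) <->
        extension_property (nerve M) (horn_incl (inord 1 : 'I_4)) &
      partial_operation (@mu M) <->
        extension_property (nerve M) (horn_incl (inord 2 : 'I_4))].
Proof.
split; rewrite horn3_extensionP /= ?inordK //.
- split=> [canc a01 a02 a03 a12 a13 a23 | fill a1 a2 b c m1 m2].
    move=> /(_ ltac:(done)) m012 /(_ ltac:(done)) m013 /(_ ltac:(done)) m023 _;
      split=> //.
    have [x mx /canc /(_ m013) xa] := mu_assocl m012 m023.
    by rewrite -xa.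
  (* Taking the unit [target b] as edge 12, the missing face 123 reads [mu (a1, target b) a2]. *)
  have [et mt] := targetP b.
  by have [|||//|_ _ _ /(mu_eta_r et)] := fill b b c (target b) a2 a1.
- split=> [canc a01 a02 a03 a12 a13 a23 | fill a b1 b2 c m1 m2].
    move=> _ /(_ ltac:(done)) m013 /(_ ltac:(done)) m023 /(_ ltac:(done)) m123;
      split=> //.
    have [x mx /canc /(_ m023) xa] := mu_assocr m123 m013.
    by rewrite -xa.
  (* Edge 12 is the unit [source a]; the missing face 012 reads [mu (source a, b1) b2]. *)
  have [es ms] := sourceP a.
  by have [//||||/(mu_eta_l es)] := fill b1 b2 c (source a) a a.
- split=> [func a01 a02 a03 a12 a13 a23 | fill a b c1 c2 m1 m2].
    move=> /(_ ltac:(done)) m012 /(_ ltac:(done)) m013 _ /(_ ltac:(done)) m123;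
      split=> //.
    have [x /(func _ _ _ _ m012) <- //] := mu_assocr m123 m013.
  (* Edge 23 is the unit [target a]; the missing face 023 reads [mu (target a, c1) c2]. *)
  have [et mt] := targetP a.
  by have [||//||_ _ /(mu_eta_l et)] := fill b c1 c2 a a (target a).
- split=> [func a01 a02 a03 a12 a13 a23 | fill a b c1 c2 m1 m2].
    move=> /(_ ltac:(done)) m012 _ /(_ ltac:(done)) m023 /(_ ltac:(done)) m123;
      split=> //.
    have [x /(func _ _ _ _ m123) <- //] := mu_assocl m012 m023.
  (* Edge 01 is the unit [source b]; the missing face 013 reads [mu (c1, source b) c2]. *)
  have [es ms] := sourceP b.
  by have [|//|||_ /(mu_eta_r es)] := fill (source b) b c2 b c1 a.
Qed.
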